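(* For each $0\le k\le\lfloor m/2\rfloor$, there is an isomorphism of $S_m$-modules $$P_k\cong S^{(m-k,k)},$$ where $P_k=\ker(D_-:A_k\to A_{k-1})$ and $S^{(m-k,k)}$ is the Specht module (over $\mathbb C$) of the symmetric group $S_m$ corresponding to the partition $(m-k,k)$ of $m$.
   Context: Let $m=\binom n2$, where $n$ is the number of vertices, and $[m]=\{1,\dots,m\}$. The graph algebra is $\mathcal A=\mathbb C[x_1,\dots,x_m]/(x_1^2-x_1,\dots,x_m^2-x_m)$, with vector space basis $\boldsymbol{x}_S=\prod_{e\in S}x_e$, $S\subseteq[m]$. The group $S_m$ acts linearly on $\mathcal A$ by $\sigma\cdot\boldsymbol{x}_S=\boldsymbol{x}_{\sigma(S)}$. For $0\le k\le m$, $A_k=\operatorname{span}_{\mathbb C}\{\boldsymbol{x}_S:|S|=k\}$, and $A_{-1}=0$. The linear operator $D_-$ is defined by $D_-(\boldsymbol{x}_S)=\sum_{e\in S}\boldsymbol{x}_{S\setminus\{e\}}$, with $D_-(\boldsymbol{x}_\varnothing)=0$; it commutes with the $S_m$-action, so $P_k$ is an $S_m$-submodule of $A_k$. *)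

(* Defs.v *)
From HB Require Import structures.
From mathcomp Require Import all_boot all_order all_fingroup all_algebra.
From mathcomp Require Import boolp reals complex mpoly.

Set Implicit Arguments.
Unset Strict Implicit.
Unset Printing Implicit Defensive.

Import GRing.Theory.

Local Open Scope ring_scope.
Local Open Scope quotient_scope.

Section GraphAlgebra.
Variables (F : fieldType) (m : nat).
Implicit Types (S T U : {set 'I_m}) (c : F) (e : 'I_m) (p q : {mpoly F[m]}).

(* Membership in the ideal generated by the x_e^2 - x_e, as a (classical)
   boolean so that the quotient construction of the library applies. *)
Definition gideal : {mpoly F[m]} -> bool :=
  fun p => `[< exists q : 'I_m -> {mpoly F[m]},
                 p = \sum_(e < m) q e * ('X_e ^+ 2 - 'X_e) >].

Definition geval T p : F := p.@[fun e => (e \in T)%:R].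

Lemma geval_gideal T p : gideal p -> geval T p = 0.
Proof.
move=> /asboolP[q ->]; rewrite /geval raddf_sum big1 //= => e _.
rewrite mevalM mevalB rmorphXn /= mevalXU.
by case: (e \in T); rewrite ?expr0n ?expr1n subrr mulr0.
Qed.

Fact gideal_closed : idealr_closed gideal.
Proof.
split.
- by apply/asboolP; exists (fun=> 0); rewrite big1 // => e _; rewrite mul0r.
- apply/negP => /(geval_gideal set0) /eqP.
  by rewrite /geval meval1 oner_eq0.
- move=> a p q /asboolP[u ->] /asboolP[v ->]; apply/asboolP.
  exists (fun e => a * u e + v e); rewrite mulr_sumr -big_split /=.
  by apply: eq_bigr => e _; rewrite mulrDl mulrA.
Qed.

HB.instance Definition _ := isIdealr.Build {mpoly F[m]} gideal gideal_closed.

(* F[x_1, ..., x_m] / (x_1^2 - x_1, ..., x_m^2 - x_m), the variables being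
   indexed by 'I_m = {0, ..., m-1} instead of {1, ..., m}. *)
Definition galg : Type := {ideal_quot (gideal : idealr _)}.

HB.instance Definition _ := GRing.ComNzRing.on galg.
HB.instance Definition _ := NzRingQuotient.on galg.

Definition gpi p : galg := \pi_galg p.

Fact gpi_is_additive : additive gpi.
Proof. by move=> p q; rewrite /gpi rmorphB. Qed.
Fact gpi_is_monoid_morphism : monoid_morphism gpi.
Proof. by split=> [|p q]; rewrite /gpi ?rmorph1 ?rmorphM. Qed.
HB.instance Definition _ := GRing.isAdditive.Build _ _ gpi gpi_is_additive.
HB.instance Definition _ :=
  GRing.isMonoidMorphism.Build _ _ gpi gpi_is_monoid_morphism.

Lemma gpi_eq p q : (gpi p == gpi q) = gideal (p - q).
Proof. exact/esym/(Quotient.idealrBE (gideal : idealr _)). Qed.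

Lemma gpi_surj (a : galg) : exists p, a = gpi p.
Proof. by exists (generic_quotient.repr a); rewrite /gpi reprK. Qed.

Definition gscale c (a : galg) : galg := gpi c%:MP * a.

Fact gscaleA c d a : gscale c (gscale d a) = gscale (c * d) a.
Proof. by rewrite /gscale mulrA -rmorphM mpolyCM. Qed.
Fact gscale1 : left_id 1 gscale.
Proof. by move=> a; rewrite /gscale mpolyC1 rmorph1 mul1r. Qed.
Fact gscaleDr : right_distributive gscale +%R.
Proof. by move=> c a b; rewrite /gscale mulrDr. Qed.
Fact gscaleDl a : {morph gscale^~ a : c d / c + d}.
Proof. by move=> c d; rewrite /gscale mpolyCD rmorphD mulrDl. Qed.

HB.instance Definition _ :=
  GRing.Zmodule_isLmodule.Build F galg gscaleA gscale1 gscaleDr gscaleDl.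

Fact gscaleAl c (a b : galg) : c *: (a * b) = (c *: a) * b.
Proof. exact: mulrA. Qed.
HB.instance Definition _ := GRing.Lmodule_isLalgebra.Build F galg gscaleAl.
HB.instance Definition _ := GRing.Lalgebra_isComAlgebra.Build F galg.

Fact gpi_is_scalable : scalable gpi.
Proof. by move=> c p; rewrite -mul_mpolyC rmorphM. Qed.
HB.instance Definition _ :=
  GRing.isScalable.Build F {mpoly F[m]} galg *:%R gpi gpi_is_scalable.

Definition gvar e : galg := gpi 'X_e.

(* The monomial x_S; these form a basis, see gcoord_gmon and gcoordE. *)
Definition gmon S : galg := \prod_(e in S) gvar e.

Lemma gvar_idem e : gvar e ^+ 2 = gvar e.
Proof.
apply/eqP; rewrite /gvar -rmorphXn gpi_eq; apply/asboolP.
exists (fun i => (i == e)%:R); rewrite (bigD1 e) //= eqxx mul1r big1 ?addr0 //.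
by move=> i /negPf->; rewrite mul0r.
Qed.

Lemma gvarX e k : gvar e ^+ k.+1 = gvar e.
Proof.
by elim: k => [|k IHk]; rewrite ?expr1 // exprS IHk -expr2 gvar_idem.
Qed.

Lemma gpi_mon (d : 'X_{1..m}) : gpi 'X_[d] = gmon [set e | d e != 0%N].
Proof.
rewrite mpolyXE_id rmorph_prod /gmon [RHS]big_mkcond /=.
apply: eq_bigr => e _; rewrite inE rmorphXn -/(gvar e).
by case: (d e) => [|k]; rewrite ?expr0 ?gvarX.
Qed.

Lemma gmon_mul S T : gmon S * gmon T = gmon (S :|: T).
Proof.
rewrite /gmon 3!(big_mkcond (fun e => e \in _)) -big_split /=.
apply: eq_bigr => e _; rewrite !inE.
by case: (e \in S); case: (e \in T); rewrite ?mulr1 ?mul1r // -expr2 gvar_idem.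
Qed.

(* The coefficient of x_S, obtained by Moebius inversion from the values at the
   indicator vectors of the subsets T (which do not depend on the
   representative, see geval_repr): the product below is (-1)^#|S \ T| if T is
   contained in S, and 0 otherwise. *)
Definition gcoord S (a : galg) : F :=
  \sum_(T : {set 'I_m})
    (\prod_e (if e \in T then (e \in S)%:R else (-1) ^+ (e \in S)))
      * geval T (generic_quotient.repr a).

Lemma geval_repr T p : geval T (generic_quotient.repr (gpi p)) = geval T p.
Proof.
apply/eqP; rewrite -subr_eq0 -mevalB; apply/eqP/geval_gideal.
by rewrite -gpi_eq /gpi reprK.
Qed.

Fact gcoord_is_linear S : linear_for *%R (gcoord S).
Proof.
move=> c a b; have [p ->] := gpi_surj a; have [q ->] := gpi_surj b.
rewrite -linearP /gcoord mulr_sumr -big_split /=; apply: eq_bigr => T _.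
by rewrite !geval_repr /geval mevalD mevalZ mulrDr mulrCA.
Qed.
HB.instance Definition _ S :=
  GRing.isLinear.Build F galg F *%R (gcoord S) (gcoord_is_linear S).

Lemma gcoord_gmon S T : gcoord S (gmon T) = (S == T)%:R.
Proof.
have evT U : geval U (generic_quotient.repr (gmon T))
    = \prod_e (if e \in U then 1 else (e \notin T)%:R).
  have -> : gmon T = gpi (\prod_(e in T) 'X_e) by rewrite rmorph_prod.
  rewrite geval_repr /geval rmorph_prod big_mkcond /=; apply: eq_bigr => e _.
  by rewrite mevalXU; case: (e \in T); case: (e \in U).
rewrite /gcoord; under eq_bigr => U _ do rewrite evT -big_split /=.
transitivity (\prod_e ((e \in S) == (e \in T))%:R : F).
  rewrite (eq_bigr (fun e =>
      (e \in S)%:R + (-1) ^+ (e \in S) * (e \notin T)%:R)) => [|e _].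
    rewrite bigA_distr; apply: eq_bigr => U _; apply: eq_bigr => e _.
    by case: (e \in U); rewrite ?mulr1.
  by case: (e \in S); case: (e \in T);
    rewrite /= ?mulr1 ?mulr0 ?addr0 ?add0r ?expr0 ?expr1 ?subrr.
have [->|neST] := eqVneq S T; first by apply: big1 => e _; rewrite eqxx.
have [e eST] : exists e, (e \in S) != (e \in T).
  apply/existsP; apply: contraR neST; rewrite negb_exists => /forallP eqST.
  by apply/eqP/setP => e; apply/eqP/negbNE/eqST.
by rewrite (bigD1 e) //= (negPf eST) mul0r.
Qed.

Lemma gcoordE a : a = \sum_S gcoord S a *: gmon S.
Proof.
have [p ->] := gpi_surj a; rewrite {1 2}[p]mpolyE !raddf_sum /=.
under [RHS]eq_bigr => S _ do rewrite !raddf_sum scaler_suml /=.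
rewrite exchange_big /=; apply: eq_bigr => d _.
rewrite gpi_is_scalable gpi_mon (bigD1 [set e | d e != 0%N]) //=.
rewrite big1 => [|S /negPf neS]; last first.
  by rewrite linearZ /= gcoord_gmon neS mulr0 scale0r.
by rewrite addr0 linearZ /= gcoord_gmon eqxx mulr1.
Qed.

Fact galg_vector_axiom : Vector.axiom #|{set 'I_m}| galg.
Proof.
exists (fun a => \row_i gcoord (enum_val i) a).
  by move=> c a b; apply/rowP => i; rewrite !mxE linearP.
exists (fun v : 'rV_#|{set 'I_m}| => \sum_i v 0 i *: gmon (enum_val i)) => [a|v].
  rewrite [RHS]gcoordE [RHS](reindex _ (onW_bij _ (@enum_val_bij _))).
  by apply: eq_bigr => i _; rewrite mxE.
apply/rowP => i; rewrite !mxE raddf_sum (bigD1 i) //= big1 => [|j neji].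
  by rewrite addr0 linearZ /= gcoord_gmon eqxx mulr1.
by rewrite linearZ /= gcoord_gmon (inj_eq enum_val_inj) eq_sym (negPf neji) mulr0.
Qed.
HB.instance Definition _ :=
  Lmodule_hasFinDim.Build F galg galg_vector_axiom.

End GraphAlgebra.

(* Permutations in the library compose from left to right: (s * t) x = t (s x).
   A left module over the classical symmetric group, where (t s) v = t (s v),
   is therefore a family of operators satisfying gm_actM. *)
Record gmodule (F : fieldType) (gT : finGroupType) := GModule {
  gm_space :> vectType F;
  gm_act : gT -> 'End(gm_space);
  gm_act1 : forall v, gm_act 1%g v = v;
  gm_actM : forall g h v, gm_act (g * h)%g v = gm_act h (gm_act g v)
}.

Definition gm_iso (F : fieldType) (gT : finGroupType) (V W : gmodule F gT) :=
  exists f : 'Hom(V, W),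
    bijective f /\ forall g v, f (gm_act V g v) = gm_act W g (f v).

Section Submodule.
Variables (F : fieldType) (gT : finGroupType) (V : gmodule F gT).
Variables (U : {vspace V}).
Hypothesis U_stable : forall g, (gm_act V g @: U <= U)%VS.

Definition submod_act g : 'End(subvs_of U) :=
  linfun (vsproj U \o gm_act V g \o vsval).

Lemma submod_actE g (u : subvs_of U) :
  vsval (submod_act g u) = gm_act V g (vsval u).
Proof.
rewrite lfunE /= vsprojK //.
exact: (subvP (U_stable g)) _ (memv_img _ (subvsP u)).
Qed.

Fact submod_act1 u : submod_act 1%g u = u.
Proof. by apply: subvs_inj; rewrite submod_actE gm_act1. Qed.

Fact submod_actM g h u : submod_act (g * h)%g u = submod_act h (submod_act g u).
Proof. by apply: subvs_inj; rewrite !submod_actE gm_actM. Qed.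

Definition submod : gmodule F gT := GModule submod_act1 submod_actM.
End Submodule.

Section GraphModule.
Variables (F : fieldType) (m : nat).
Implicit Types (S : {set 'I_m}) (s : 'S_m) (a : galg F m).

(* The linear map sending x_S to f S, see gextend_gmon. *)
Definition gextend (f : {set 'I_m} -> galg F m) a : galg F m :=
  \sum_S gcoord S a *: f S.

Fact gextend_is_linear f : linear (gextend f).
Proof.
move=> c a b; rewrite /gextend scaler_sumr -big_split /=.
by apply: eq_bigr => S _; rewrite linearP scalerDl scalerA.
Qed.
HB.instance Definition _ f :=
  GRing.isLinear.Build F (galg F m) (galg F m) *:%R (gextend f)
    (gextend_is_linear f).

Lemma gextend_gmon f S : linfun (gextend f) (gmon F S) = f S.
Proof.
rewrite lfunE /= /gextend (bigD1 S) //= gcoord_gmon eqxx scale1r.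
by rewrite big1 ?addr0 // => T /negPf neTS; rewrite gcoord_gmon neTS scale0r.
Qed.

Lemma gmon_lfun_eq (f g : 'End(galg F m)) :
  (forall S, f (gmon F S) = g (gmon F S)) -> f = g.
Proof.
move=> eqfg; apply/lfunP => a; rewrite [a]gcoordE !linear_sum /=.
by apply: eq_bigr => S _; rewrite !linearZ /= eqfg.
Qed.

(* D_- *)
Definition gminus : 'End(galg F m) :=
  linfun (gextend (fun S => \sum_(e in S) gmon F (S :\ e))).

Definition gact s : 'End(galg F m) :=
  linfun (gextend (fun S => gmon F (s @: S))).

Lemma gminus_gmon S : gminus (gmon F S) = \sum_(e in S) gmon F (S :\ e).
Proof. exact: gextend_gmon. Qed.

Lemma gact_gmon s S : gact s (gmon F S) = gmon F (s @: S).
Proof. exact: gextend_gmon. Qed.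

Fact gact1 a : gact 1%g a = a.
Proof.
suff -> : gact 1%g = \1%VF by rewrite lfunE.
apply: gmon_lfun_eq => S; rewrite gact_gmon lfunE /=; congr gmon.
by rewrite -[RHS]imset_id; apply: eq_imset => e; rewrite perm1.
Qed.

Fact gactM s t a : gact (s * t)%g a = gact t (gact s a).
Proof.
rewrite -comp_lfunE; congr (fun_of_lfun _ a); apply: gmon_lfun_eq => S.
rewrite comp_lfunE /= !gact_gmon -imset_comp; congr gmon.
by apply: eq_imset => e; rewrite permM.
Qed.

Definition galg_module : gmodule F 'S_m := GModule gact1 gactM.

Lemma gminus_gact s a : gminus (gact s a) = gact s (gminus a).
Proof.
rewrite -!comp_lfunE; congr (fun_of_lfun _ a); apply: gmon_lfun_eq => S.
rewrite !comp_lfunE gact_gmon !gminus_gmon linear_sum /=.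
rewrite big_imset /=; last by move=> e f _ _; apply: perm_inj.
apply: eq_bigr => e _; rewrite gact_gmon; congr gmon.
apply/setP => f; rewrite -[f](permKV s) !inE (inj_eq perm_inj).
by rewrite !(mem_imset _ _ (@perm_inj _ s)) !inE.
Qed.

(* A_k *)
Definition gdeg k : {vspace galg F m} :=
  <<[seq gmon F A | A in [pred A : {set 'I_m} | #|A| == k]]>>%VS.

(* P_k, the kernel of the restriction of D_- to A_k. *)
Definition gprim k : {vspace galg F m} := (gdeg k :&: lker gminus)%VS.

Fact gprim_stable k s : (gact s @: gprim k <= gprim k)%VS.
Proof.
apply/subvP => _ /memv_imgP[a + ->]; rewrite !memv_cap !memv_ker.
case/andP=> Aa /eqP Da; rewrite gminus_gact Da linear0 eqxx andbT.
have: gact s a \in (gact s @: gdeg k)%VS by apply: memv_img.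
apply: subvP; rewrite limg_span; apply/span_subvP => _ /mapP[_ /imageP[S + ->] ->].
rewrite inE => cS; rewrite gact_gmon; apply/memv_span/imageP.
by exists (s @: S); rewrite // inE card_imset //; apply: perm_inj.
Qed.

Definition gprim_module k : gmodule F 'S_m :=
  @submod F 'S_m galg_module (gprim k) (gprim_stable k).
End GraphModule.

(* James's construction of the Specht module S^la, for a partition la of m given
   as the sequence of its parts (trailing zero parts are harmless: they add
   rows without cells). *)
Section Specht.
Variables (F : fieldType) (m : nat) (la : seq nat).

Definition cell := {i : 'I_(size la) & 'I_(nth 0%N la i)}.
Definition cell_row (c : cell) : 'I_(size la) := tag c.
Definition cell_col (c : cell) : nat := tagged c.

(* Each of the m entries occurs exactly once. *)
Definition is_tableau (t : {ffun cell -> 'I_m}) : bool :=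
  [forall e, #|[set c | t c == e]| == 1%N].
Definition tableau := {t : {ffun cell -> 'I_m} | is_tableau t}.

Fact tableau_act_subproof (s : 'S_m) (t : tableau) :
  is_tableau [ffun c => s (val t c)].
Proof.
apply/forallP => e; move/forallP: (valP t) => /(_ (s^-1%g e)) /eqP <-.
apply/eqP/eq_card => c; rewrite !inE ffunE -[in LHS](permKV s e).
by rewrite (inj_eq perm_inj).
Qed.
Definition tableau_act s t : tableau := Sub _ (tableau_act_subproof s t).

Definition tableau_row (t : tableau) (i : 'I_(size la)) : {set 'I_m} :=
  [set val t c | c : cell & cell_row c == i].
Definition tableau_col (t : tableau) (j : nat) : {set 'I_m} :=
  [set val t c | c : cell & cell_col c == j].

(* A tabloid is a row-equivalence class of tableaux; it is represented by the
   sequence of the (unordered) rows, which two tableaux share if and only if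
   they are row equivalent. *)
Definition is_tabloid (T : {ffun 'I_(size la) -> {set 'I_m}}) : bool :=
  [exists t : tableau, T == [ffun i => tableau_row t i]].
Definition tabloid :=
  {T : {ffun 'I_(size la) -> {set 'I_m}} | is_tabloid T}.

Fact tabloid_of_subproof (t : tableau) :
  is_tabloid [ffun i => tableau_row t i].
Proof. by apply/existsP; exists t. Qed.
Definition tabloid_of t : tabloid := Sub _ (tabloid_of_subproof t).

Lemma tableau_row_act s t i :
  tableau_row (tableau_act s t) i = s @: tableau_row t i.
Proof.
by rewrite /tableau_row -imset_comp; apply: eq_imset => c; rewrite /= ffunE.
Qed.

Lemma tableau_col_act s t j :
  tableau_col (tableau_act s t) j = s @: tableau_col t j.
Proof.
by rewrite /tableau_col -imset_comp; apply: eq_imset => c; rewrite /= ffunE.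
Qed.

Fact tabloid_act_subproof (s : 'S_m) (T : tabloid) :
  is_tabloid [ffun i => s @: val T i].
Proof.
have /existsP[t /eqP defT] := valP T; apply/existsP; exists (tableau_act s t).
by apply/eqP/ffunP => i; rewrite !ffunE defT ffunE tableau_row_act.
Qed.
Definition tabloid_act s T : tabloid := Sub _ (tabloid_act_subproof s T).

Lemma tabloid_act_of s t :
  tabloid_act s (tabloid_of t) = tabloid_of (tableau_act s t).
Proof.
by apply: val_inj; apply/ffunP => i; rewrite /= !ffunE tableau_row_act.
Qed.

(* The permutation module M^la: the free vector space on the tabloids. *)
Local Notation tabmod := {ffun tabloid -> F^o}.

Definition tabvec (T : tabloid) : tabmod := [ffun T' => (T' == T)%:R].

Definition tabextend (f : tabloid -> tabmod) (v : tabmod) : tabmod :=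
  \sum_T v T *: f T.
Fact tabextend_is_linear f : linear (tabextend f).
Proof.
move=> c a b; rewrite /tabextend scaler_sumr -big_split /=.
by apply: eq_bigr => S _; rewrite !ffunE scalerDl scalerA.
Qed.
HB.instance Definition _ f :=
  GRing.isLinear.Build F tabmod tabmod *:%R (tabextend f) (tabextend_is_linear f).

Lemma tabvecE (v : tabmod) : v = \sum_T v T *: tabvec T.
Proof.
apply/ffunP => T; rewrite sum_ffunE (bigD1 T) //= !ffunE eqxx.
rewrite big1 => [|T' neT]; first by rewrite addr0 [_ *: _]mulr1.
by rewrite !ffunE eq_sym (negPf neT) scaler0.
Qed.

Definition tabact (s : 'S_m) : 'End(tabmod) :=
  linfun (tabextend (fun T => tabvec (tabloid_act s T))).

Lemma tabact_tabvec s T : tabact s (tabvec T) = tabvec (tabloid_act s T).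
Proof.
rewrite lfunE /= /tabextend (bigD1 T) //= ffunE eqxx scale1r.
by rewrite big1 ?addr0 // => T' /negPf neT; rewrite ffunE neT scale0r.
Qed.

Lemma tabvec_lfun_eq (f g : 'End(tabmod)) :
  (forall T, f (tabvec T) = g (tabvec T)) -> f = g.
Proof.
move=> eqfg; apply/lfunP => a; rewrite [a]tabvecE !linear_sum /=.
by apply: eq_bigr => S _; rewrite !linearZ /= eqfg.
Qed.

Fact tabact1 (v : tabmod) : tabact 1%g v = v.
Proof.
suff -> : tabact 1%g = \1%VF by rewrite lfunE.
apply: tabvec_lfun_eq => T; rewrite tabact_tabvec lfunE /=; congr tabvec.
apply: val_inj; apply/ffunP => i; rewrite /= ffunE.
by rewrite -[RHS]imset_id; apply: eq_imset => e; rewrite perm1.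
Qed.

Fact tabactM s t v : tabact (s * t)%g v = tabact t (tabact s v).
Proof.
rewrite -comp_lfunE; congr (fun_of_lfun _ v); apply: tabvec_lfun_eq => T.
rewrite comp_lfunE /= !tabact_tabvec; congr tabvec.
apply: val_inj; apply/ffunP => i; rewrite /= !ffunE -imset_comp.
by apply: eq_imset => e; rewrite permM.
Qed.

Definition tabmod_module : gmodule F 'S_m := GModule tabact1 tabactM.

Definition col_stab (t : tableau) : {set 'S_m} :=
  [set s : 'S_m | [forall c : cell,
     s @: tableau_col t (cell_col c) == tableau_col t (cell_col c)]].

Definition polytabloid (t : tableau) : tabmod :=
  \sum_(s in col_stab t) (-1) ^+ s *: tabvec (tabloid_of (tableau_act s t)).

Definition specht_space : {vspace tabmod} :=
  <<[seq polytabloid t | t : tableau]>>%VS.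

Lemma tableau_actM s u t : tableau_act (s * u)%g t = tableau_act u (tableau_act s t).
Proof. by apply: val_inj; apply/ffunP => c; rewrite /= !ffunE permM. Qed.

Lemma col_stab_act s t : col_stab (tableau_act s t) = (col_stab t :^ s)%g.
Proof.
apply/setP => u; rewrite mem_conjg !inE; apply: eq_forallb => c.
rewrite tableau_col_act; move: (tableau_col t _) => C.
rewrite -(inj_eq (imset_inj (@perm_inj _ s^-1%g))).
have -> : s^-1%g @: (s @: C) = C.
  rewrite -imset_comp -[RHS]imset_id.
  by apply: eq_imset => e; rewrite /= permK.
congr (_ == _); rewrite -!imset_comp.
by apply: eq_imset => e; rewrite /= conjgE !permM invgK.
Qed.

Lemma tabact_polytabloid s t :
  tabact s (polytabloid t) = polytabloid (tableau_act s t).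
Proof.
rewrite /polytabloid linear_sum /= col_stab_act.
rewrite [RHS](reindex_inj (conjg_inj s)) /=.
apply: eq_big => [u|u _]; first by rewrite memJ_conjg.
rewrite linearZ /= tabact_tabvec tabloid_act_of odd_permJ -!tableau_actM.
by rewrite conjgE !mulgA mulgV mul1g.
Qed.

Fact specht_stable s : (tabact s @: specht_space <= specht_space)%VS.
Proof.
rewrite limg_span; apply/span_subvP => _ /mapP[_ /imageP[t _ ->] ->].
rewrite tabact_polytabloid; apply/memv_span/imageP.
by exists (tableau_act s t).
Qed.

Definition specht_module : gmodule F 'S_m :=
  @submod F 'S_m tabmod_module specht_space specht_stable.
End Specht.

(* Main.v *)
Require Import Defs.
From HB Require Import structures.
From mathcomp Require Import all_boot all_order all_fingroup all_algebra.
From mathcomp Require Import boolp reals complex mpoly.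

(** A tabloid of shape (m - k, k) is determined by its bottom row, a k-subset
    of 'I_m, so the tabloid module M is the space A_k in disguise: x_S
    corresponds to the tabloid with bottom row S.  Under this equivariant
    identification (tabloid_map) the polytabloid of a tableau t, with bottom row
    B and column group C, is the image of eps_t = sum_(s in C) sgn(s) x_(s B).
    The theorem says that the eps_t span P_k.

    Each eps_t lies in P_k (gminus_alt_gmon): removing b from B leaves a set
    fixed by the transposition of b with the top entry of its column, so the
    terms of D_- eps_t that come from b cancel in pairs.  This is where
    k <= m / 2 enters: every bottom entry needs an entry above it.

    Conversely, every v in P_k is recovered from the translates of a single
    eps_t by the formula
      sum_(s in S_m) v(s B) (s eps_t) = c v,  with c > 0
    (gprim_reproducing), which replaces any dimension count or basis of standard
    tableaux.  The coefficient of x_U on the left is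
      sum_(s in C) sgn(s) g(s B)  with  g(X) = sum_(u | u B = U) v(u X),
    and g, like v, is killed by D_-, but it is also invariant under the
    stabiliser of B.  Such a function is determined by its value at B: if U
    misses a and b, with b in B and a outside B, then the equation
    D_- g = 0 at U has only two distinct values, g(b |: U) and g(a |: U), each
    with a positive multiplicity, so these values have opposite signs and a
    fixed ratio (zonal_exchange).  Moving s B back to B one column at a time
    changes both this sign and sgn(s) at each step, so sgn(s) g(s B) is
    a positive multiple of g(B) (zonal_column_group).  Hence the sum is a
    positive multiple of g(B), which is v(U) times the order of the
    stabiliser of B.

    The formula gives both halves of the isomorphism: tabloid_map sends
    P_k onto the span of the polytabloids, and it is injective on P_k since the
    left side only involves values of v that tabloid_map remembers. *)

Set Implicit Arguments.
Unset Strict Implicit.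
Unset Printing Implicit Defensive.

Import Order.TTheory GRing.Theory Num.Theory.

Local Open Scope ring_scope.

(** * Coordinates in the graph algebra *)

Section Coordinates.
Variables (F : fieldType) (m : nat).
Implicit Types (S U : {set 'I_m}) (s : 'S_m) (a : galg F m).

Lemma gcoord_inj a b : (forall S, gcoord S a = gcoord S b) -> a = b.
Proof.
move=> eqab; rewrite [a]gcoordE [b]gcoordE.
by apply: eq_bigr => S _; rewrite eqab.
Qed.

Lemma gcoord_gminus U a :
  gcoord U (gminus F m a) = \sum_(e | e \notin U) gcoord (e |: U) a.
Proof.
rewrite {1}[a]gcoordE !linear_sum /=.
under eq_bigr => S _ do rewrite !linearZ /= gminus_gmon linear_sum mulr_sumr.
rewrite (exchange_big_dep predT) //= [RHS]big_mkcond /=; apply: eq_bigr => e _.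
case: ifPn => [eU | /negPn eU].
  rewrite (bigD1 (e |: U)) ?setU11 //= gcoord_gmon setU1K // eqxx mulr1.
  rewrite big1 ?addr0 // => S /andP[eS /negPf neS]; rewrite gcoord_gmon.
  have [defU|] := eqVneq; rewrite ?mulr0 //.
  by rewrite defU setD1K ?eqxx in neS.
apply: big1 => S _; rewrite gcoord_gmon; have [defU|] := eqVneq; rewrite ?mulr0 //.
by rewrite defU setD11 in eU.
Qed.

Lemma imset_permM s t U : (s * t)%g @: U = t @: (s @: U).
Proof. by rewrite -imset_comp; apply: eq_imset => e; rewrite permM. Qed.

Lemma imset_perm1 U : (1%g : 'S_m) @: U = U.
Proof. by rewrite -[RHS]imset_id; apply: eq_imset => e; rewrite perm1. Qed.

Lemma imset_permK s : cancel (fun U => s @: U) (fun U => (s^-1)%g @: U).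
Proof. by move=> U; rewrite -imset_permM mulgV imset_perm1. Qed.

Lemma imset_permKV s : cancel (fun U => (s^-1)%g @: U) (fun U => s @: U).
Proof. by move=> U; rewrite -imset_permM mulVg imset_perm1. Qed.

Lemma imset_perm_inj s : injective (fun U => s @: U).
Proof. exact: can_inj (imset_permK s). Qed.

Lemma imset_tperm_swap e f U :
  e \notin U -> f \notin U -> tperm e f @: (e |: U) = f |: U.
Proof.
move=> eU fU; rewrite imsetU1 tpermL; congr (_ |: _).
rewrite -[RHS]imset_id; apply: eq_in_imset => x xU; rewrite tpermD //.
  by apply: contraNneq eU => ->.
by apply: contraNneq fU => ->.
Qed.

Lemma imset_tperm_out e f U :
  e \notin U -> f \notin U -> tperm e f @: U = U.
Proof.
move=> eU fU; rewrite -[RHS]imset_id; apply: eq_in_imset => x xU; rewrite tpermD //.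
  by apply: contraNneq eU => ->.
by apply: contraNneq fU => ->.
Qed.

Lemma imset_tperm_in e f U :
  e \in U -> f \in U -> tperm e f @: U = U.
Proof.
move=> eU fU; apply/eqP.
rewrite eqEcard card_imset ?leqnn ?andbT; last exact: perm_inj.
by apply/subsetP => _ /imsetP[x xU ->]; case: tpermP => // ->.
Qed.

(** Exchange an element of S outside U with one of U outside S, and induct on
    the number of such elements. *)
Lemma card_eq_imset_perm S U : #|S| = #|U| -> exists s : 'S_m, s @: S = U.
Proof.
move: {2}#|_ :\: _|.+1 (ltnSn #|S :\: U|) => n.
elim: n S => // n IHn S leSn eqSU.
have [SU|] := boolP (S \subset U).
  by exists 1%g; rewrite imset_perm1; apply/eqP; rewrite eqEcard SU eqSU leqnn.
case/subsetPn => e eS eU.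
have: ~~ (U \subset S).
  apply: contra eU => US; suff -> : U = S by [].
  by apply/eqP; rewrite eqEcard US eqSU leqnn.
case/subsetPn => f fU fS.
have defS : e |: S :\ e = S by rewrite setD1K.
have e1 : e \notin S :\ e by rewrite setD11.
have f1 : f \notin S :\ e by rewrite !inE (negPf fS) andbF.
have [||s sS] := IHn (f |: S :\ e).
- apply: leq_trans (leSn : (_ <= n)%N); apply: proper_card; apply/properP; split.
    apply/subsetP => x; rewrite !inE; case: eqP => [->|_]; first by rewrite fU.
    by case/and3P => -> _ ->.
  by exists e; rewrite !inE ?eS ?eU ?eqxx //= orbF; apply: contraNneq fS => <-.
- by rewrite cardsU1 f1 -eqSU (cardsD1 e S) eS.
exists (tperm e f * s)%g.
by rewrite imset_permM -sS -{1}defS imset_tperm_swap.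
Qed.

Lemma gcoord_gact s U a : gcoord (s @: U) (Defs.gact F s a) = gcoord U a.
Proof.
rewrite {1}[a]gcoordE [in RHS](gcoordE a) !linear_sum /=; apply: eq_bigr => S _.
by rewrite !linearZ /= gact_gmon !gcoord_gmon (inj_eq (@imset_perm_inj s)).
Qed.

Lemma gmon_gdeg S : gmon F S \in gdeg F m #|S|.
Proof. by apply/memv_span/imageP; exists S; rewrite ?inE. Qed.

Lemma gcoord_gdeg k a S : a \in gdeg F m k -> #|S| != k -> gcoord S a = 0.
Proof.
move=> Aa neS.
have ker : (gdeg F m k <= lker (linfun (gcoord S : galg F m -> F^o)))%VS.
  apply/span_subvP => _ /imageP[T + ->]; rewrite inE => /eqP cT.
  rewrite memv_ker lfunE /= gcoord_gmon; have [defS|] := eqVneq S T => //.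
  by rewrite defS cT eqxx in neS.
by move/(subvP ker): Aa; rewrite memv_ker lfunE /= => /eqP.
Qed.

End Coordinates.

(** * Alternating sums over the column group *)

Section ColumnGroup.
Variables (F : numFieldType) (m : nat).
(** All that matters about a two-row tableau: its bottom row B and the column of
    each entry.  The entries outside B form the top row, so that col is injective
    on each row, and every entry of B has another one above it. *)
Variables (B : {set 'I_m}) (col : 'I_m -> nat).
Hypothesis col_injB : {in B &, injective col}.
Hypothesis col_injC : {in ~: B &, injective col}.
Hypothesis col_partner : forall b, b \in B -> exists2 a, a \notin B & col a = col b.

Definition column_group : {set 'S_m} := [set s : 'S_m | [forall x, col (s x) == col x]].

Definition alt_gmon : galg F m :=
  \sum_(s in column_group) (-1) ^+ s *: gmon F (s @: B).

Lemma column_groupP (s : 'S_m) :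
  reflect (forall x, col (s x) = col x) (s \in column_group).
Proof. by rewrite inE; apply/(iffP forallP) => h x; apply/eqP. Qed.

Lemma column_groupM : {in column_group &, forall s t, (s * t)%g \in column_group}.
Proof.
move=> s t /column_groupP cs /column_groupP ct; apply/column_groupP => x.
by rewrite permM ct cs.
Qed.

Lemma column_groupV s : (s^-1%g \in column_group) = (s \in column_group).
Proof.
have imp u : u \in column_group -> u^-1%g \in column_group.
  move=> /column_groupP cu; apply/column_groupP => x.
  by rewrite -{2}[x](permKV u) cu.
by apply/idP/idP => /imp; rewrite ?invgK.
Qed.

Lemma column_group_tperm a b : col a = col b -> tperm a b \in column_group.
Proof. by move=> eab; apply/column_groupP => x; case: tpermP => // ->. Qed.

Lemma alt_gmon_gdeg : alt_gmon \in gdeg F m #|B|.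
Proof.
apply: memv_suml => s _; apply: memvZ.
rewrite -[#|B|](card_imset _ (@perm_inj _ s)); exact: gmon_gdeg.
Qed.

(** For each b in B, with partner a, precomposing with the transposition of a and
    b fixes s @: (B :\ b) and reverses the sign of s, so the terms
    from which s b is removed add up to their own opposite. *)
Lemma gminus_alt_gmon : gminus F m alt_gmon = 0.
Proof.
rewrite linear_sum /=.
under eq_bigr => s _.
  rewrite linearZ /= gminus_gmon big_imset /=; last by move=> e f _ _; apply: perm_inj.
  rewrite scaler_sumr; over.
rewrite exchange_big /=; apply: big1 => b bB.
have [a aB eab] := col_partner bB.
set X := \sum_(s in _) _.
suff : X = - X.
  move/eqP; rewrite -addr_eq0 -mulr2n -scaler_nat scaler_eq0 pnatr_eq0 /=.
  by move/eqP.
rewrite {1}/X (reindex_inj (mulgI (tperm a b))) -sumrN /=.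
have ctau := column_group_tperm eab.
apply: eq_big => [s|s _].
  apply/idP/idP => [cs|]; last exact: column_groupM.
  by rewrite -[s](mulKg (tperm a b)) tpermV; apply: column_groupM.
have neab : a != b by apply: contraNneq aB => ->.
have defD (u : 'S_m) : u @: B :\ u b = u @: (B :\ b).
  apply/setP => x; rewrite -[x](permKV u) !inE (inj_eq perm_inj).
  by rewrite !(mem_imset _ _ (@perm_inj _ u)) !inE.
rewrite !defD imset_permM imset_tperm_out ?setD11 //; last first.
  by rewrite !inE (negPf aB) andbF.
by rewrite odd_permM odd_tperm neab signr_addb mulN1r scaleNr.
Qed.

Lemma column_group_fixed s : s \in column_group -> s @: B = B -> s = 1%g.
Proof.
move=> /column_groupP cs sB; apply/permP => x; rewrite perm1.
have sBx : (s x \in B) = (x \in B) by rewrite -{1}sB (mem_imset _ _ (@perm_inj _ s)).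
have [xB|xB] := boolP (x \in B).
  by apply: col_injB => //; rewrite sBx.
by apply: col_injC => //; rewrite inE ?sBx.
Qed.

(** The coordinate functions of the elements of ker D_- that are
    invariant under the stabiliser of B; the name is that of the spherical functions
    of the pair (S_m, stabiliser of B). *)
Definition zonal (g : {set 'I_m} -> F) :=
  (forall s : 'S_m, s @: B = B -> forall X : {set 'I_m}, g (s @: X) = g X) /\
  (forall U : {set 'I_m}, \sum_(e | e \notin U) g (e |: U) = 0).

(** The transpositions of two elements of B, or of two elements outside
    B, stabilise B; hence g (e |: U) takes only two values, according to whether
    e is in B, and the kernel equation at U reads
    p * g (b |: U) + q * g (a |: U) = 0 with p, q > 0. *)
Lemma zonal_exchange (U : {set 'I_m}) a b :
    a \notin B -> a \notin U -> b \in B -> b \notin U ->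
  exists2 r : F, 0 < r & forall g, zonal g -> g (a |: U) = - (r * g (b |: U)).
Proof.
move=> aB aU bB bU.
pose p := #|[set e | (e \notin U) && (e \in B)]|.
pose q := #|[set e | (e \notin U) && (e \notin B)]|.
have p0 : (0 < p)%N by apply/card_gt0P; exists b; rewrite inE bU.
have q0 : (0 < q)%N by apply/card_gt0P; exists a; rewrite inE aU.
exists (p%:R / q%:R); first by rewrite divr_gt0 ?ltr0n.
move=> g [ginv /(_ U)]; rewrite (bigID (mem B)) /=.
rewrite (eq_bigr (fun=> g (b |: U))) => [|e /andP[eU eB]]; last first.
  by rewrite -(imset_tperm_swap bU eU) ginv // imset_tperm_in.
rewrite [X in _ + X](eq_bigr (fun=> g (a |: U))) => [|e /andP[eU eB]]; last first.
  by rewrite -(imset_tperm_swap aU eU) ginv // imset_tperm_out.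
rewrite !sumr_const; rewrite -[X in _ *+ X + _]cardsE -[X in _ + _ *+ X]cardsE.
rewrite -/p -/q -[_ *+ p]mulr_natl -[_ *+ q]mulr_natl => /eqP.
rewrite addrC addr_eq0 => /eqP E; apply: (@mulfI _ q%:R).
  by rewrite pnatr_eq0 -lt0n.
by rewrite E mulrN [in RHS]mulrA [q%:R * _]mulrC divfK // pnatr_eq0 -lt0n.
Qed.

(** Induction on the number of columns where s moves the bottom entry up.  If
    a = s b is such a top entry, composing with the transposition of a and b
    replaces a by b in s @: B; by zonal_exchange the sign of g changes along with
    that of the permutation.  The ratio r is chosen before g because
    the constants for different g have to agree in gprim_reproducing. *)
Lemma zonal_column_group s : s \in column_group ->
  exists2 r : F, 0 < r & forall g, zonal g -> (-1) ^+ s * g (s @: B) = r * g B.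
Proof.
move: {2}#|_ :\: _|.+1 (ltnSn #|s @: B :\: B|) => n.
elim: n s => // n IHn s lesn cs.
have [sB|] := boolP (s @: B \subset B).
  have defs : s = 1%g.
    apply: column_group_fixed => //; apply/eqP.
    by rewrite eqEcard sB card_imset ?leqnn //; apply: perm_inj.
  by exists 1 => // g _; rewrite defs odd_perm1 expr0 !mul1r imset_perm1.
case/subsetPn => _ /imsetP[b bB ->] aB; set a := s b in aB.
have /column_groupP cs' := cs.
have eab : col a = col b by apply: cs'.
have bsB : b \notin s @: B.
  apply/imsetP => -[x xB defb].
  have defx : x = b by apply: col_injB => //; rewrite -cs' -defb.
  by rewrite /a -defx -defb bB in aB.
have asB : a \in s @: B by apply: imset_f.
pose U := s @: B :\ a.
have aU : a \notin U by rewrite setD11.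
have bU : b \notin U by rewrite !inE (negPf bsB) andbF.
have defsB : s @: B = a |: U by rewrite setD1K.
have ctau := column_group_tperm eab.
have defsB' : (s * tperm a b)%g @: B = b |: U.
  by rewrite imset_permM defsB imset_tperm_swap.
have [||r r0 Er] := IHn (s * tperm a b)%g; last 1 first.
- have [q q0 Eq] := zonal_exchange aB aU bB bU.
  exists (q * r) => [|g gz]; first exact: mulr_gt0.
  have neab : a != b by apply: contraNneq aB => ->.
  rewrite -mulrA -(Er _ gz) defsB' defsB Eq // odd_permM odd_tperm neab.
  by rewrite signr_addb mulrN1 mulNr !mulrN mulrCA.
- apply: leq_trans (lesn : (_ <= n)%N); apply: proper_card; apply/properP; split.
    rewrite defsB' defsB; apply/subsetP => x; rewrite !inE.
    by case/andP => xB /orP[/eqP xb|->]; [rewrite xb bB in xB | rewrite xB orbT].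
  exists a; first by rewrite inE aB.
  rewrite defsB' !inE eqxx orbF aB /=.
  by apply: contraNneq aB => ->.
- exact: column_groupM.
Qed.

Lemma zonal_alt_sum : exists2 c : F, 0 < c & forall g, zonal g ->
  \sum_(s in column_group) (-1) ^+ s * g (s @: B) = c * g B.
Proof.
have : forall s, exists r : F, s \in column_group ->
    0 < r /\ forall g, zonal g -> (-1) ^+ s * g (s @: B) = r * g B.
  move=> s; have [/zonal_column_group[r r0 Er]|ncs] := boolP (s \in column_group).
    by exists r.
  by exists 0.
case/fin_all_exists => r Hr.
exists (\sum_(s in column_group) r s).
  have c1 : 1%g \in column_group by apply/column_groupP => x; rewrite perm1.
  rewrite (bigD1 1%g) //= ltr_pwDl ?(Hr _ c1).1 // sumr_ge0 // => s /andP[cs _].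
  by case: (Hr _ cs) => /ltW.
by move=> g gz; rewrite mulr_suml; apply: eq_bigr => s /Hr[_]; apply.
Qed.

(** Summing v over the permutations that send B to U: precomposition with an
    element of the stabiliser of B permutes these, and D_- commutes with each. *)
Lemma zonal_transfer (v : galg F m) (U : {set 'I_m}) : gminus F m v = 0 ->
  zonal (fun X => \sum_(u : 'S_m | u @: B == U) gcoord (u @: X) v).
Proof.
move=> Dv; split=> [s sB X|W].
  rewrite [RHS](reindex_inj (mulgI s)) /=; apply: eq_big => [u|u _].
    by rewrite imset_permM sB.
  by rewrite imset_permM.
rewrite exchange_big /=; apply: big1 => u _.
have := gcoord_gminus (u @: W) v; rewrite Dv linear0 => E; rewrite [RHS]E.
rewrite [RHS](reindex_inj (@perm_inj _ u)) /=; apply: eq_big => [e|e _].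
  by rewrite (mem_imset _ _ (@perm_inj _ u)).
by rewrite imsetU1.
Qed.

(** The coefficient of x_U collects the pairs of s in S_m and t in the column
    group with s (t B) = U.  Summing over u, the composite of t and s, gives
    the left side of zonal_alt_sum for the function of zonal_transfer, whose value
    at B is v(U) times the number of u sending B to U. *)
Lemma gprim_reproducing : exists2 c : F, c != 0 &
  forall v, v \in gprim F m #|B| ->
  \sum_(s : 'S_m) gcoord (s @: B) v *: Defs.gact F s alt_gmon = c *: v.
Proof.
have [c c0 Ec] := zonal_alt_sum.
pose N := #|[set u : 'S_m | u @: B == B]|.
have N0 : (0 < N)%N by apply/card_gt0P; exists 1%g; rewrite inE imset_perm1.
exists (c * N%:R) => [|v]; first by rewrite mulf_neq0 ?gt_eqF // ltr0n.
rewrite memv_cap memv_ker => /andP[Av /eqP Dv]; apply: gcoord_inj => U.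
rewrite linear_sum linearZ /=.
transitivity (\sum_(t in column_group) (-1) ^+ t *
    \sum_(u : 'S_m | u @: B == U) gcoord (u @: (t @: B)) v).
  (* Put t^-1 for t, and u = t * s, that is t followed by s:
     then u @: (t^-1 @: B) = s @: B. *)
  rewrite [RHS](reindex_inj invg_inj) /=.
  under [RHS]eq_bigl => t do rewrite column_groupV.
  under [RHS]eq_bigr => t _.
    rewrite odd_permV (reindex_inj (mulgI t)) mulr_sumr /= big_mkcond /=.
    over.
  rewrite [RHS]exchange_big /=; apply: eq_bigr => s _.
  rewrite /alt_gmon linearZ !linear_sum /= mulr_sumr; apply: eq_bigr => t _.
  rewrite !linearZ /= gact_gmon gcoord_gmon -!imset_permM mulKg eq_sym.
  by case: eqP => _; rewrite ?mulr0 // mulr1 mulrC.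
rewrite (Ec _ (zonal_transfer U Dv)) -mulrA; congr (_ * _).
rewrite (eq_bigr (fun=> gcoord U v)) => [|u /eqP-> //].
rewrite sumr_const -[LHS]mulr_natl.
(* If #|U| != #|B| no permutation sends B to U, but then v(U) = 0 as well. *)
have [cU|/(gcoord_gdeg Av)->] := eqVneq #|U| #|B|; last by rewrite !mulr0.
have [w wB] := card_eq_imset_perm (esym cU).
congr (_%:R * _); transitivity #|[set u : 'S_m | u @: B == U]|.
  by rewrite cardsE.
rewrite -[N](card_imset _ (mulIg w)); apply: eq_card => u.
rewrite -[u](mulgKV w); move: (u * w^-1)%g => t.
rewrite (mem_imset _ _ (@mulIg _ w)) !inE imset_permM -{1}wB.
by rewrite (inj_eq (@imset_perm_inj _ w)).
Qed.

End ColumnGroup.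

(** * Submodules that correspond under an equivariant map *)

Lemma submod_iso (F : fieldType) (gT : finGroupType) (V W : gmodule F gT)
    (phi : 'Hom(V, W)) (U : {vspace V}) (X : {vspace W})
    (hU : forall g, (gm_act V g @: U <= U)%VS)
    (hX : forall g, (gm_act W g @: X <= X)%VS) :
    (forall g v, phi (gm_act V g v) = gm_act W g (phi v)) ->
    (phi @: U)%VS = X -> (U :&: lker phi = 0)%VS ->
  gm_iso (submod hU) (submod hX).
Proof.
move=> phi_act im_phi ker_phi.
pose f : 'Hom(subvs_of U, subvs_of X) := linfun (vsproj X \o phi \o vsval).
have fE u : vsval (f u) = phi (vsval u).
  by rewrite lfunE /= vsprojK // -im_phi memv_img ?subvsP.
exists f; split=> [|g u]; last first.
  apply: subvs_inj; apply: (etrans (fE _)).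
  apply: (etrans (congr1 phi (submod_actE hU g u))); apply: (etrans (phi_act _ _)).
  apply/esym/(etrans (submod_actE hX g (f u))); congr (gm_act W g _); exact: fE.
have kerf : lker f == 0%VS.
  rewrite -subv0; apply/subvP => u; rewrite memv_ker memv0 => /eqP fu0.
  apply/eqP/subvs_inj/eqP; rewrite linear0 -memv0 -ker_phi memv_cap subvsP.
  by rewrite memv_ker -fE fu0 linear0 eqxx.
exists (f^-1)%VF; first exact: lker0_lfunK.
move=> w; have : vsval w \in (phi @: U)%VS by rewrite im_phi subvsP.
case/memv_imgP => a Ua wa.
suff -> : w = f (vsproj U a) by rewrite lker0_lfunK.
by apply: subvs_inj; rewrite fE vsprojK.
Qed.

(** * Tableaux as bijections *)

Section TableauEntries.
Variables (m : nat) (la : seq nat).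
Implicit Types (t : tableau m la) (c d : cell la).

Lemma tableau_bij t : exists p : 'I_m -> cell la, cancel (val t) p /\ cancel p (val t).
Proof.
have : forall e, exists c, [set d | val t d == e] = [set c].
  by move=> e; apply/cards1P; move/forallP: (valP t).
case/fin_all_exists => p Hp; exists p.
have memp c e : (val t c == e) = (c == p e).
  by move/setP/(_ c): (Hp e); rewrite !inE.
by split=> [c|e]; apply/eqP; [rewrite eq_sym -memp | rewrite memp].
Qed.

Lemma cell_inj c d : cell_row c = cell_row d -> cell_col c = cell_col d -> c = d.
Proof.
case: c d => [i j] [i' j'] /= eqi; rewrite /cell_row /= in eqi.
by case: _ / eqi j' => j' /val_inj /= ->.
Qed.

Lemma tableau_of_size : sumn la = m -> tableau m la.
Proof.
move=> sum_la; have cardc : #|{: cell la}| = #|'I_m|.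
  rewrite card_ord card_tagged -sum_la; congr sumn.
  rewrite -[RHS](mkseq_nth 0%N) /mkseq -val_enum_ord -map_comp enumT.
  by apply: eq_map => i; rewrite /= card_ord.
pose f c : 'I_m := enum_val (cast_ord cardc (enum_rank c)).
have finj : injective f.
  by move=> c d /enum_val_inj/cast_ord_inj/enum_rank_inj.
have ft : is_tableau [ffun c => f c].
  apply/forallP => e; have /codomP[c ->] := inj_card_onto finj (eq_leq (esym cardc)) e.
  apply/cards1P; exists c; apply/setP => d; rewrite !inE ffunE; exact: inj_eq.
exact: Sub _ ft.
Qed.

End TableauEntries.

(** * Two-row tableaux, and the isomorphism *)

Section TwoRows.
Variables (F : numFieldType) (m k : nat).
Hypothesis le_k_m2 : (k <= m./2)%N.
Notation la := [:: (m - k)%N; k].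
Notation tabloid := (tabloid m la).
Notation tableau := (tableau m la).
Implicit Types (T : tabloid) (t : tableau) (s : 'S_m).

Definition bottom : 'I_(size la) := ord_max.

Lemma le_k_top : (k <= m - k)%N.
Proof.
have le_2k_m : (k.*2 <= m)%N.
  apply: leq_trans (_ : m./2.*2 <= m)%N; first by rewrite leq_double.
  by rewrite -[leqRHS]odd_double_half leq_addl.
by rewrite leq_subRL ?addnn // (leq_trans _ le_2k_m) // -addnn leq_addl.
Qed.

Lemma two_row_tableau : tableau.
Proof.
apply: tableau_of_size; rewrite /= addn0 subnK //.
exact: leq_trans le_k_top (leq_subr _ _).
Qed.

Lemma card_bottom t : #|tableau_row t bottom| = k.
Proof.
have [p [tK pK]] := tableau_bij t.
rewrite card_imset; last exact: can_inj tK.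
pose f (j : 'I_k) : cell la := existT (fun i : 'I_(size la) => 'I_(nth 0%N la i)) bottom j.
rewrite -[RHS]card_ord -(card_imset _ (f := f)); last first.
  by move=> i j /(congr1 (@cell_col _))/val_inj.
apply: eq_card => c; rewrite !inE; apply/eqP/imsetP => [|[j _ ->]] //.
by case: c => i j /= ri; rewrite /cell_row /= in ri; subst i; exists j.
Qed.

(** The top row is the complement of the bottom one. *)
Lemma tabloid_eqE T T' : (T == T') = (val T bottom == val T' bottom).
Proof.
apply/eqP/eqP => [->//|eqb]; apply: val_inj; apply/ffunP => i.
have top (U : tabloid) j : j != bottom -> val U j = ~: val U bottom.
  move=> nej; have /existsP[t /eqP ->] := valP U; rewrite !ffunE.
  have [p [tK pK]] := tableau_bij t; apply/setP => x; rewrite -[x]pK !inE.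
  rewrite !(mem_imset _ _ (can_inj tK)) !inE; case: (cell_row _) nej => r lr.
  by case: j => j lj; rewrite -!val_eqE /=; case: r j lr lj => [|[|r]] [|[|j]].
by have [->|nei] := eqVneq i bottom; rewrite ?(top _ _ nei) eqb.
Qed.

Definition entry_col t (x : 'I_m) : nat :=
  (* The default is never reached: a tableau is onto. *)
  if [pick c | val t c == x] is Some c then cell_col c else 0%N.

Lemma entry_colE t c : entry_col t (val t c) = cell_col c.
Proof.
have [p [tK pK]] := tableau_bij t; rewrite /entry_col.
by case: pickP => [d /eqP/(can_inj tK) -> | /(_ c)]; rewrite ?eqxx.
Qed.

Lemma col_stabE t : col_stab t = column_group (entry_col t).
Proof.
have [p [tK pK]] := tableau_bij t.
have memC x j : (x \in tableau_col t j) = (entry_col t x == j).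
  by rewrite -[x]pK (mem_imset _ _ (can_inj tK)) inE entry_colE.
apply/setP => s; rewrite !inE; apply/forallP/forallP => [cs x|cs c].
  rewrite -[X in _ == X]/(entry_col t x) -memC -[x in entry_col t x]pK entry_colE.
  rewrite -(eqP (cs (p x))); apply: imset_f.
  by rewrite memC -(entry_colE t) pK.
rewrite eqEcard card_imset ?leqnn ?andbT; last exact: perm_inj.
by apply/subsetP => _ /imsetP[x + ->]; rewrite !memC (eqP (cs x)).
Qed.

Lemma entry_col_injB t : {in tableau_row t bottom &, injective (entry_col t)}.
Proof.
have [p [tK pK]] := tableau_bij t.
move=> x y; rewrite -[x]pK -[y]pK !(mem_imset _ _ (can_inj tK)) !inE.
move=> /eqP rx /eqP ry; rewrite !entry_colE => exy; congr (val t _).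
by apply: cell_inj; rewrite ?rx.
Qed.

Lemma entry_col_injC t : {in ~: tableau_row t bottom &, injective (entry_col t)}.
Proof.
have [p [tK pK]] := tableau_bij t.
move=> x y; rewrite -[x]pK -[y]pK !inE !(mem_imset _ _ (can_inj tK)) !inE.
move=> rx ry; rewrite !entry_colE => exy; congr (val t _); apply: cell_inj => //.
move: rx ry; case: (cell_row _) => i li; case: (cell_row _) => j lj.
by rewrite -!val_eqE /= => ni nj; apply: val_inj; case: i j li lj ni nj => [|[|i]] [|[|j]].
Qed.

Lemma entry_col_partner t b : b \in tableau_row t bottom ->
  exists2 a, a \notin tableau_row t bottom & entry_col t a = entry_col t b.
Proof.
have [p [tK pK]] := tableau_bij t.
rewrite -[b]pK (mem_imset _ _ (can_inj tK)) inE => /eqP rb.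
have lt_b : (cell_col (p b) < m - k)%N.
  apply: leq_trans le_k_top; case: (p b) rb => i j /=; rewrite /cell_row /cell_col /=.
  by move=> ei; subst i; exact: ltn_ord.
pose d : cell la := existT (fun i : 'I_(size la) => 'I_(nth 0%N la i)) ord0 (Ordinal lt_b).
exists (val t d); last by rewrite !entry_colE.
by rewrite (mem_imset _ _ (can_inj tK)) inE.
Qed.

Definition tabloid_map (a : galg F m) : {ffun tabloid -> F^o} :=
  [ffun T : tabloid => (gcoord (val T bottom) a : F^o)].

Fact tabloid_map_is_linear : linear tabloid_map.
Proof. by move=> c a b; apply/ffunP => T; rewrite !ffunE linearP. Qed.
HB.instance Definition _ :=
  GRing.isLinear.Build F (galg F m) {ffun tabloid -> F^o} *:%R tabloid_map
    tabloid_map_is_linear.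

Lemma tabact_perm s (v : {ffun tabloid -> F^o}) T :
  tabact F la s v (tabloid_act s T) = v T.
Proof.
rewrite lfunE /= /tabextend sum_ffunE (bigD1 T) //= !ffunE eqxx.
rewrite big1 ?addr0 => [|T' neT]; first exact: mulr1.
rewrite !ffunE tabloid_eqE /= !ffunE (inj_eq (@imset_perm_inj _ s)) -tabloid_eqE.
by rewrite eq_sym (negPf neT) scaler0.
Qed.

Lemma tabloid_actKV s T : tabloid_act s (tabloid_act s^-1%g T) = T.
Proof. by apply/eqP; rewrite tabloid_eqE /= !ffunE imset_permKV. Qed.

Lemma tabloid_map_act s a :
  tabloid_map (Defs.gact F s a) = tabact F la s (tabloid_map a).
Proof.
apply/ffunP => T; rewrite -[T](tabloid_actKV s) tabact_perm !ffunE.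
exact: gcoord_gact.
Qed.

Definition bottom_alt t : galg F m :=
  alt_gmon F (tableau_row t bottom) (entry_col t).

Lemma tabloid_map_alt t : tabloid_map (bottom_alt t) = polytabloid F t.
Proof.
apply/ffunP => T; rewrite ffunE linear_sum sum_ffunE col_stabE /=.
apply: eq_bigr => s _; rewrite linearZ /= !ffunE gcoord_gmon tabloid_eqE /= ffunE.
by rewrite tableau_row_act.
Qed.

Lemma bottom_alt_gprim t : bottom_alt t \in gprim F m k.
Proof.
rewrite memv_cap memv_ker -{1}(card_bottom t) alt_gmon_gdeg.
by rewrite gminus_alt_gmon ?eqxx //; apply: entry_col_partner.
Qed.

Lemma gprim_reproducing_tableau t : exists2 c : F, c != 0 &
  forall v, v \in gprim F m k ->
  \sum_(s : 'S_m) gcoord (s @: tableau_row t bottom) v *: Defs.gact F s (bottom_alt t)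
    = c *: v.
Proof.
have := @gprim_reproducing F m _ _ (@entry_col_injB t) (@entry_col_injC t).
by rewrite card_bottom; apply.
Qed.

(** A polytabloid is the image of bottom_alt t; conversely the reproducing formula
    for one tableau t writes every element of P_k as a combination of the translates
    of bottom_alt t, and the translates of a polytabloid are polytabloids. *)
Lemma limg_tabloid_map :
  (linfun tabloid_map @: gprim F m k)%VS = specht_space F m la.
Proof.
have t := two_row_tableau.
apply/eqP; rewrite eqEsubv; apply/andP; split; last first.
  apply/span_subvP => _ /imageP[u _ ->]; rewrite -tabloid_map_alt -[tabloid_map _]lfunE.
  exact/memv_img/bottom_alt_gprim.
have [c c0 Ec] := gprim_reproducing_tableau t.
apply/subvP => _ /memv_imgP[v Pv ->]; rewrite -[v](scalerK c0) -Ec // lfunE /=.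
rewrite linearZ linear_sum; apply/memvZ/memv_suml => s _; rewrite linearZ /=.
rewrite tabloid_map_act tabloid_map_alt tabact_polytabloid.
by apply/memvZ/memv_span/imageP; exists (tableau_act s t).
Qed.

(** The reproducing formula involves v only through its coordinates at the sets
    s @: B, each of which is the bottom row of a tabloid. *)
Lemma lker_tabloid_map : (gprim F m k :&: lker (linfun tabloid_map) = 0)%VS.
Proof.
have t := two_row_tableau.
have [c c0 Ec] := gprim_reproducing_tableau t.
apply/eqP; rewrite -subv0; apply/subvP => v; rewrite memv_cap memv_ker lfunE /=.
case/andP => Pv /eqP/ffunP v0; rewrite memv0 -[v](scalerK c0) -Ec //.
rewrite big1 ?scaler0 // => s _.
have := v0 (tabloid_of (tableau_act s t)); rewrite !ffunE tableau_row_act.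
by move=> ->; rewrite scale0r.
Qed.

Lemma gprim_iso_specht : gm_iso (gprim_module F m k) (specht_module F m la).
Proof.
apply: (@submod_iso F _ (galg_module F m) (tabmod_module F m la)
         (linfun tabloid_map)).
- by move=> s a; rewrite !(lfunE tabloid_map); apply: tabloid_map_act.
- exact: limg_tabloid_map.
- exact: lker_tabloid_map.
Qed.

End TwoRows.

Theorem theorem4p3 (R : realType) (n k : nat)
    (hk : (k <= 'C(n, 2)./2)%N) :
  gm_iso (gprim_module R[i] 'C(n, 2) k)
         (specht_module R[i] 'C(n, 2) [:: ('C(n, 2) - k)%N; k]).
Proof. exact: gprim_iso_specht. Qed.
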